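(* Let $A$ be a prime Novikov algebra that is not associative. Then $Z(A)=N(A)=0$.
   Context: Algebras are (not necessarily associative, not necessarily unital) algebras over a field. Write $(a,b,c)=(ab)c-a(bc)$ and $[a,b]=ab-ba$. A Novikov algebra is an algebra satisfying the identities $(a,b,c)=(b,a,c)$ and $(ab)c=(ac)b$. ''Ideal'' means two-sided ideal (a linear subspace closed under left and right multiplication by all elements of $A$). For subspaces $U,V$, the product $UV$ is the linear span of all $uv$, $u\in U$, $v\in V$. An algebra $A$ is prime if for any ideals $I,J$ of $A$, $IJ=0$ implies $I=0$ or $J=0$. The nucleus is $N(A)=\{n\in A \mid (n,a,b)=(a,n,b)=(a,b,n)=0\ \forall a,b\in A\}$, the commutative center is $K(A)=\{k\in A\mid [k,a]=0\ \forall a\in A\}$, and the center is $Z(A)=N(A)\cap K(A)$. *)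

(* Defs.v *)
From HB Require Import structures.
From mathcomp Require Import all_boot all_order all_algebra.
From mathcomp Require Import boolp classical_sets.

Set Implicit Arguments.
Unset Strict Implicit.
Unset Printing Implicit Defensive.

Import GRing.Theory.
Local Open Scope classical_set_scope.
Local Open Scope ring_scope.

(* A not necessarily associative, not necessarily unital algebra over F, of
   arbitrary dimension, is an F-vector space A with a bilinear product mul. *)
Section NonassociativeAlgebra.
Variables (F : fieldType) (A : lmodType F) (mul : {bilinear A -> A -> A}).

Definition associator (a b c : A) : A := mul (mul a b) c - mul a (mul b c).

Definition commutator (a b : A) : A := mul a b - mul b a.

Definition is_associative : Prop := forall a b c, associator a b c = 0.

Definition is_novikov : Prop :=
  (forall a b c, associator a b c = associator b a c) /\
  (forall a b c, mul (mul a b) c = mul (mul a c) b).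

Definition is_subspace (U : set A) : Prop :=
  U 0 /\ forall (k : F) (u v : A), U u -> U v -> U (k *: u + v).

Definition is_ideal (I : set A) : Prop :=
  is_subspace I /\ forall a x, I x -> I (mul a x) /\ I (mul x a).

Definition linear_span (X : set A) : set A := smallest is_subspace X.

Definition subspace_mul (U V : set A) : set A :=
  linear_span [set mul u v | u in U & v in V].

Definition is_prime_alg : Prop :=
  forall I J : set A, is_ideal I -> is_ideal J ->
    subspace_mul I J = [set 0] -> I = [set 0] \/ J = [set 0].

Definition nucleus : set A :=
  [set n | forall a b,
     [/\ associator n a b = 0, associator a n b = 0 & associator a b n = 0]].

Definition commutative_center : set A :=
  [set k | forall a, commutator k a = 0].

Definition alg_center : set A := nucleus `&` commutative_center.

End NonassociativeAlgebra.

(* Main.v *)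
(* The left nucleus L is an ideal, and so is its left annihilator. The latter
   contains every associator: for n in L, (a,b,c)n = (an,b,c) by right
   commutativity, and (an,b,c) = (a,nb,c) = (nb,a,c) = (n,a,c)b = 0. Since A is
   prime and not associative, L = 0, and L contains the nucleus. *)

Require Import Defs.
From HB Require Import structures.
From mathcomp Require Import all_boot all_order all_algebra.
From mathcomp Require Import boolp classical_sets.

Set Implicit Arguments.
Unset Strict Implicit.
Unset Printing Implicit Defensive.

Import GRing.Theory.
Local Open Scope classical_set_scope.
Local Open Scope ring_scope.

Section NovikovAlgebra.
Variables (F : fieldType) (A : lmodType F) (mul : {bilinear A -> A -> A}).

Definition left_nucleus : set A := [set n | forall a b, associator mul n a b = 0].

Definition left_annihilator (J : set A) : set A :=
  [set x | forall n, J n -> mul x n = 0].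

Lemma is_subspace_set0 : is_subspace [set 0 : A].
Proof. by split=> // k u v /= -> ->; rewrite scaler0 addr0. Qed.

Lemma subspace_mul_left_annihilator (J : set A) :
  subspace_mul mul (left_annihilator J) J = [set 0].
Proof.
apply/seteqP; split=> [|_ /= -> U [[U0 _] _] //].
apply: smallest_sub; first exact: is_subspace_set0.
by move=> _ [x xI [n nJ <-]]; exact: xI.
Qed.

Hypothesis novikovA : is_novikov mul.

Lemma associatorC a b c : associator mul a b c = associator mul b a c.
Proof. exact: novikovA.1. Qed.

Lemma mul_rightC a b c : mul (mul a b) c = mul (mul a c) b.
Proof. exact: novikovA.2. Qed.

(** Right multiplications commute with one another, so the factor [d] can be moved outermost in both
    terms: ((ad)b)c = ((ab)c)d and (ad)(bc) = (a(bc))d. *)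
Lemma associator_mull a d b c :
  associator mul (mul a d) b c = mul (associator mul a b c) d.
Proof.
rewrite /associator linearBl.
by rewrite (mul_rightC a d b) (mul_rightC (mul a b)) (mul_rightC a d).
Qed.

Lemma associator_left_nucleus0 n a b c :
  left_nucleus n -> mul (associator mul a b c) n = 0.
Proof.
move=> nL; rewrite -associator_mull.
have lassoc x y : mul (mul n x) y = mul n (mul x y).
  by apply/eqP; rewrite -subr_eq0; apply/eqP/nL.
(* Left symmetry carries the vanishing from the first slot to the second: [n] lies in the middle
   nucleus as well. *)
have massoc0 x y : associator mul x n y = 0 by rewrite associatorC nL.
have massoc x y : mul (mul x n) y = mul x (mul n y).
  by apply/eqP; rewrite -subr_eq0; apply/eqP; exact: massoc0.
(* The first terms agree by [massoc]; for the second ones, (an)(bc) = a(n(bc)) = a((nb)c). *)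
have -> : associator mul (mul a n) b c = associator mul a (mul n b) c.
  by rewrite /associator !massoc lassoc.
by rewrite associatorC associator_mull nL linear0l.
Qed.

(** By [associator_mull], (an,b,c) = (a,b,c)n and (na,b,c) = (n,b,c)a. The second vanishes by the
    choice of n, the first because n is killed by every associator. *)
Lemma left_nucleus_ideal : is_ideal mul left_nucleus.
Proof.
split; first split=> [a b|k u v uL vL a b].
- by rewrite /associator !linear0l subr0.
- have := vL a b; have := uL a b; rewrite /associator => uab vab.
  by rewrite !linearPl opprD addrACA -scalerBr uab vab scaler0 addr0.
- move=> a n nL; split=> b c; rewrite associator_mull.
    exact: associator_left_nucleus0.
  by rewrite nL linear0l.
Qed.

Lemma left_annihilator_ideal (J : set A) :
  is_ideal mul J -> is_ideal mul (left_annihilator J).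
Proof.
move=> [_ idealJ]; split; first split=> [n _|k u v uI vI n nJ].
- by rewrite linear0l.
- by rewrite linearPl uI // vI // scaler0 addr0.
- move=> a x xI.
  (* Right multiples come first because left multiples rely on them. *)
  have xaI : left_annihilator J (mul x a).
    by move=> n nJ; rewrite mul_rightC xI // linear0l.
  split=> // n nJ.
  (* In (ax)n - a(xn) = (xa)n - x(an) every term but (ax)n is zero; for x(an) this uses that an lies
     in [J]. *)
  have := associatorC a x n; rewrite /associator xaI // xI // linear0r.
  by rewrite (xI _ (idealJ a n nJ).1) !subr0.
Qed.

Lemma left_nucleus_eq0 :
  is_prime_alg mul -> ~ is_associative mul -> left_nucleus = [set 0].
Proof.
move=> primeA nassocA.
have LI := left_nucleus_ideal.
have [] // := primeA _ _ (left_annihilator_ideal LI) LI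
  (subspace_mul_left_annihilator _).
(* The other alternative of primeness, a zero annihilator, would force every associator to
   vanish. *)
move=> ann0; case: nassocA => a b c.
suff : left_annihilator left_nucleus (associator mul a b c) by rewrite ann0.
by move=> n; exact: associator_left_nucleus0.
Qed.

End NovikovAlgebra.

Theorem theorem1 (F : fieldType) (A : lmodType F) (mul : {bilinear A -> A -> A})
    (novikovA : is_novikov mul) (primeA : is_prime_alg mul)
    (nassocA : ~ is_associative mul) :
  alg_center mul = nucleus mul /\ nucleus mul = [set 0].
Proof.
have nuc0 : nucleus mul = [set 0].
  apply/seteqP; split=> [n nN|_ -> a b].
    (* Rewriting backwards turns n = 0 into membership in the left nucleus. *)
    rewrite -(left_nucleus_eq0 novikovA primeA nassocA) => a b.
    by have [] := nN a b.
  by rewrite /associator !(linear0l, linear0r) subr0.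
split=> //; rewrite /alg_center nuc0; apply/seteqP; split=> [x []//|_ -> ].
by split=> // a; rewrite /commutator linear0l linear0r subr0.
Qed.
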